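(* Let $S=(I_A,I_F,M,O)$ be a canonical Local Friendliness scenario such that $|I_F|=|I_A|-1$ and $|M_j|=2$ for all $j\in I_F$. Then $\mathcal{LF}(S)=\mathcal{B}(S)$.
   Context: Canonical (standard) Local Friendliness (LF) scenario: a quadruple $S=(I_A,I_F,M,O)$ where $I_A=\{1,\dots,N\}$ is a finite set of parties (superobservers), $I_F\subset I_A$ (possibly empty, possibly all of $I_A$) is the set of parties having a ''friend'', $M=M_1\times\dots\times M_N$ with $M_i=\{1,\dots,m_i\}$ the finite set of measurement settings of party $i$, and for each $i$ and $x_i\in M_i$ there is a finite outcome set $O_{x_i}$ (depending on $i$ and on the setting $x_i$); for $\vec x\in M$ put $O_{\vec x}=O_{x_1}\times\dots\times O_{x_N}$, and $O=\{O_{\vec x}\}_{\vec x\in M}$. The sets $I_A$, $M_i$, $O_{x_i}$ all have cardinality at least 2. The symbol $\subset$ denotes non-strict inclusion. For $J\subset I_A$, $\vec a_J$ and $\vec x_J$ denote the substrings indexed by $J$. Behaviour: a family $\wp=(\wp(\cdot|\vec x))_{\vec x\in M}$ where $\wp(\cdot|\vec x)$ is a probability distribution on $O_{\vec x}$. $\mathcal{B}(S)$: the set of behaviours admitting a local hidden variable (LHV) model, i.e. $\wp(\vec a|\vec x)=\int_\Lambda d\lambda\,p(\lambda)\prod_{i=1}^N P(a_i|x_i,\lambda)$ for all $\vec a,\vec x$, for some probability space $(\Lambda,p)$ and, for each $i$, $x_i$, $\lambda$, a probability distribution $P(\cdot|x_i,\lambda)$ on $O_{x_i}$. $\mathcal{LF}(S)$: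 the set of behaviours $\wp$ for which there exist a probability distribution $P(\vec c)$ on strings $\vec c=(c_i)_{i\in I_F}\in\prod_{i\in I_F}O_{x_i=1}$ (here $O_{x_i=1}$ is the outcome set of party $i$'s setting $1$) and, for each $\vec c$ and $\vec x\in M$, a probability distribution $P(\cdot|\vec x,\vec c)$ on $O_{\vec x}$, such that: (1) $\wp(\vec a|\vec x)=\sum_{\vec c}P(\vec a|\vec x,\vec c)P(\vec c)$; (2) (Local Agency) for every $V\subset I_A$ the marginal $P(\vec a_V|\vec x,\vec c)$ depends on $\vec x$ only through $\vec x_V$; (3) with $F_{\vec x}=\{i\in I_F: x_i=1\}$, $P(\vec a_{F_{\vec x}}|\vec x,\vec c)=\prod_{i\in F_{\vec x}}\delta_{a_i,c_i}$. Equivalently $\wp(\vec a|\vec x)=\sum_{\vec c}\prod_{i\in F_{\vec x}}\delta_{a_i,c_i}\,P(\vec a_{J_{\vec x}}|\vec x_{J_{\vec x}},\vec c)\,P(\vec c)$ with $J_{\vec x}=I_A\setminus F_{\vec x}$, the $P(\cdot|\cdot,\vec c)$ satisfying Local Agency. If $I_F=\emptyset$, $\vec c$ is the empty string. *)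

(* Defs.v *)
From HB Require Import structures.
From mathcomp Require Import all_boot all_order all_algebra.
From mathcomp Require Import all_classical all_reals all_analysis.
Set Implicit Arguments.
Unset Strict Implicit.
Unset Printing Implicit Defensive.
Import Order.TTheory GRing.Theory Num.Theory.
Local Open Scope classical_set_scope.
Local Open Scope ring_scope.

(* Settings are 0-based: the setting written 1 on paper is [first_setting]. *)
Record scenario := Scenario {
  nparty : nat;
  friends : {set 'I_nparty};
  nsetting : 'I_nparty -> nat;
  outcome : forall i : 'I_nparty, 'I_(nsetting i) -> finType;
  nparty_ge2 : (2 <= nparty)%N;
  nsetting_ge2 : forall i, (2 <= nsetting i)%N;
  outcome_ge2 : forall i (s : 'I_(nsetting i)), (2 <= #|outcome s|)%N
}.

Section LocalFriendliness.
Variables (R : realType) (S : scenario).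

Definition party := 'I_(nparty S).
Definition setting (i : party) := 'I_(nsetting i).
Definition first_setting (i : party) : setting i :=
  Ordinal (ltnW (nsetting_ge2 i)).

Definition member (V : {set party}) := {i : party | i \in V}.

(* Strings of settings are plain dependent functions, so that the outcome
   types of a substring of settings reduce to those of the full string. *)
Definition settings := forall i : party, setting i.
Definition subsettings (V : {set party}) := forall i : member V, setting (val i).
Definition restr_settings (V : {set party}) (x : settings) : subsettings V :=
  fun i => x (val i).
Arguments restr_settings V x : clear implicits.

Definition outcomes (x : settings) := {dffun forall i : party, outcome (x i)}.
Definition suboutcomes (V : {set party}) (y : subsettings V) :=
  {dffun forall i : member V, outcome (y i)}.
Definition restr_outcomes (V : {set party}) (x : settings) (a : outcomes x) :
    suboutcomes (restr_settings V x) :=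
  [ffun i : member V => a (val i)].
Arguments restr_outcomes V {x} a.

Definition is_distr (T : finType) (p : T -> R) : Prop :=
  (forall t, 0 <= p t) /\ \sum_t p t = 1.

Definition marginal (V : {set party}) (x : settings) (p : outcomes x -> R)
    (aV : suboutcomes (restr_settings V x)) : R :=
  \sum_(a : outcomes x | restr_outcomes V a == aV) p a.

Definition family := forall x : settings, outcomes x -> R.

Definition behaviour (p : family) : Prop := forall x, is_distr (p x).

Definition LHV : set family := [set p | behaviour p /\
  exists (d : measure_display) (L : measurableType d) (mu : probability L R)
         (P : forall (i : party) (s : setting i), L -> outcome s -> R),
  [/\ forall i (s : setting i) l, is_distr (P i s l),
      forall i (s : setting i) (o : outcome s),
        measurable_fun setT (fun l => P i s l o)
    & forall x (a : outcomes x),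
        (p x a)%:E = (\int[mu]_l (\prod_(i : party) P i (x i) l (a i))%:E)%E]].

Definition friend_outcomes :=
  suboutcomes (fun i : member (friends S) => first_setting (val i)).

(* "The marginal on V depends on x only through x_V" is stated as
   factorization through the restriction of x to V. *)
Definition local_agency (P : family) : Prop :=
  forall V : {set party},
  exists Q : forall y : subsettings V, suboutcomes y -> R,
  forall x (aV : suboutcomes (restr_settings V x)),
    marginal (P x) aV = Q (restr_settings V x) aV.

Definition opened (x : settings) : {set party} :=
  [set i in friends S | x i == first_setting i].

(* a_i and c_i live in the outcome types of x_i and of the first setting, which
   are only propositionally equal when i \in opened x; hence the Kronecker
   delta compares them in the sigma type over settings. *)
Definition delta (x : settings) (a : outcomes x) (c : friend_outcomes)
    (i : member (friends S)) : R :=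
  (Tagged (@outcome S (val i)) (a (val i)) ==
   Tagged (@outcome S (val i)) (c i))%:R.

Definition LF : set family := [set p | behaviour p /\
  exists (Pc : friend_outcomes -> R) (P : friend_outcomes -> family),
  [/\ is_distr Pc /\ (forall c, behaviour (P c)),
      forall x (a : outcomes x), p x a = \sum_c P c x a * Pc c,
      forall c, local_agency (P c)
    & forall c x (a : outcomes x),
        marginal (P c x) (restr_outcomes (opened x) a) =
        \prod_(i : member (friends S) | val i \in opened x) delta a c i]].

End LocalFriendliness.

Arguments LHV R S : clear implicits.
Arguments LF R S : clear implicits.

(* Main.v *)
(** A local hidden variable model can be coarse-grained to a distribution w over
    deterministic strategies g.  Taking c to be the answers of g to the first
    settings of the friends and P(.|x,c) to be the distribution of the answers
    to x under w conditioned on c yields a Local Friendliness model.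

    Conversely, let k be the only party without a friend, and fix c.  A friend
    has to answer c_i to the first setting, so the only free choice is the
    answer to the other one.  Draw b from P(.|x',c), where every friend has the
    second setting in x'; friend i answers c_i or b_i according to the setting,
    and party k samples from the distribution of a_k given that the friends'
    outcomes at their second settings are b.  Local Agency, applied to the set
    of friends and to the set of parties whose outcome is not fixed by c, shows
    that this local model reproduces P(.|x,c). *)
Require Import Defs.
From HB Require Import structures.
From mathcomp Require Import all_boot all_order all_algebra.
From mathcomp Require Import all_classical all_reals all_analysis.
From mathcomp Require Import measurable_realfun ring.
Set Implicit Arguments.
Unset Strict Implicit.
Unset Printing Implicit Defensive.
Import Order.TTheory GRing.Theory Num.Theory.
Local Open Scope classical_set_scope.
Local Open Scope ring_scope.

(** * Finite sums and conditional expectations *)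

Lemma prodr_sum_dffun (R : comNzRingType) (I : finType) (T : I -> finType)
    (F : forall i, T i -> R) :
  \prod_i \sum_(j : T i) F i j =
  \sum_(g : {dffun forall i, T i}) \prod_i F i (g i).
Proof.
pose F' i := [ffun j : T i => F i j].
have -> : \prod_i \sum_(j : T i) F i j = \prod_i \sum_(j : T i) F' i j.
  by apply: eq_bigr => i _; apply: eq_bigr => j _; rewrite ffunE.
(* The dependent factors are glued into one tagged type, where ordinary distributivity applies. *)
under eq_bigr do rewrite (big_tag F').
rewrite bigA_distr_big_dep -big_fprod.
rewrite (reindex (@fprod_of_dffun _ T)); last exact/onW_bij/fprod_of_dffun_bij.
by apply: eq_bigr => g _; apply: eq_bigr => i _; rewrite fprodE ffunE.
Qed.

Lemma sum_fiber (R : nmodType) (I J : finType) (f : I -> J) (A : pred J)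
    (F : I -> R) :
  \sum_(j | A j) \sum_(i | f i == j) F i = \sum_(i | A (f i)) F i.
Proof.
rewrite [RHS](partition_big f A)//; apply: eq_bigr => j Aj; apply: eq_bigl => i.
by case: eqP => [->|]; rewrite ?Aj ?andbT ?andbF.
Qed.

(** The tower property: [g] is a function of [u], and the quotient is the conditional probability of
    [h] given [u]. The default [d b] is met only where [D b = 0], which forces [p b = 0]. *)
Lemma sum_cond_expectation (R : realFieldType) (T : finType) (K : eqType)
    (u : T -> K) (p g d : T -> R) (h : pred T) :
  (forall a, 0 <= p a) -> (forall a b, u a = u b -> g a = g b) ->
  let D b := \sum_(a | u a == u b) p a in
  \sum_b p b * (g b * (if D b == 0 then d b
                       else (\sum_(a | (u a == u b) && h a) p a) / D b)) =
  \sum_(a | h a) p a * g a.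
Proof.
move=> p_ge0 gE D.
have p_le_D b : p b <= D b by rewrite /D (bigD1 b)//= lerDl sumr_ge0.
have D_eq0 b : D b = 0 -> p b = 0.
  by move=> D0; apply/eqP; rewrite eq_le p_ge0 -D0 p_le_D.
transitivity (\sum_b \sum_(a | (u a == u b) && h a) p a * g a / D a * p b).
  apply: eq_bigr => b _; case: eqVneq => [/D_eq0 pb0|_].
    by rewrite pb0 mul0r big1// => a _; rewrite mulr0.
  rewrite mulr_suml !mulr_sumr; apply: eq_bigr => a /andP[/eqP uab _].
  by rewrite (gE _ _ uab) {2}/D uab -/(D b); ring.
rewrite (exchange_big_dep h)/=; last by move=> b a _ /andP[].
apply: eq_bigr => a ha; rewrite -mulr_sumr.
under eq_bigl => b do rewrite ha andbT eq_sym.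
rewrite -/(D a); have [/D_eq0 ->|Da] := eqVneq (D a) 0; first by rewrite !mul0r.
by rewrite divfK.
Qed.

(** * Finite hidden variable models and deterministic strategies *)

Section FiniteModels.
Variables (R : realType) (S : scenario).

(** The hidden variable becomes an index into the enumeration of [T], drawn from a weighted sum of
    Dirac masses on [nat], where every function is measurable. *)
Lemma LHV_of_finite (p : Defs.family R S) (T : finType) (w : T -> R)
    (P : forall (i : party S) (s : setting i), T -> outcome s -> R) :
  behaviour p -> is_distr w ->
  (forall i (s : setting i) t, is_distr (P i s t)) ->
  (forall x (a : outcomes x), p x a = \sum_t w t * \prod_i P i (x i) t (a i)) ->
  LHV R S p.
Proof.
move=> bp [w_ge0 w_sum1] P_distr pE; split => //.
have [t0 _|T0] := pickP {: T}; last first.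
  by move: w_sum1; rewrite big_pred0// => /eqP; rewrite eq_sym oner_eq0.
pose v (n : nat) : {nonneg R} := NngNum (w_ge0 (nth t0 (enum T) n)).
pose m : {measure set nat -> \bar R} ^nat :=
  fun n => mscale (v n) (@dirac _ nat n R).
pose mu : {measure set nat -> \bar R} := msum m #|T|.
have sumT (f : T -> R) : \sum_(n < #|T|) f (nth t0 (enum T) n) = \sum_t f t.
  by rewrite -[in RHS]big_enum (big_nth t0) -cardE big_mkord.
have muT : mu setT = 1%E.
  rewrite /mu /= /msum.
  under eq_bigr => n _ do rewrite /m /= /mscale /= diracT mule1.
  by rewrite sumEFin (sumT w) w_sum1.
have [pmu pmuE] : exists P : probability nat R, (P : set nat -> \bar R) = mu.
  pose hmu := Measure_isProbability.Build _ nat R mu muT.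
  by exists (HB.pack (Measure.sort mu) hmu : probability nat R).
exists _, nat, pmu.
exists (fun i s n => P i s (nth t0 (enum T) n)); split.
- by move=> i s n; exact: P_distr.
- by move=> i s o _ Y _; exact: I.
move=> x a; rewrite pE.
have P_ge0 i t (o : outcome (x i)) : 0 <= P i (x i) t o.
  by case: (P_distr i (x i) t).
rewrite pmuE.
pose f (l : nat) : \bar R := (\prod_i P i (x i) (nth t0 (enum T) l) (a i))%:E.
have mf : measurable_fun [set: nat] f by move=> ? ? ?.
have f_ge0 l : [set: nat] l -> (0 <= f l)%E.
  by move=> _; rewrite lee_fin prodr_ge0.
rewrite -/f ge0_integral_measure_sum//.
under [RHS]eq_bigr => n _.
  rewrite /m /= ge0_integral_mscale// integral_dirac// diracT mul1e -EFinM.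
  over.
by rewrite sumEFin (sumT (fun t => w t * \prod_i P i (x i) t (a i))).
Qed.

Definition strategy :=
  {dffun forall u : {i : party S & setting i}, outcome (tagged u)}.

Definition play (g : strategy) (x : settings S) : outcomes x :=
  [ffun i => g (Tagged _ (x i))].

(** Given [l], answering all settings of all parties independently yields the strategy [g] with
    probability [f g l]; integrating out [l] gives [w]. *)
Lemma LHV_strategies (p : Defs.family R S) : LHV R S p ->
  exists2 w : strategy -> R, is_distr w &
    forall x (a : outcomes x), p x a = \sum_(g | play g x == a) w g.
Proof.
case=> _ [d [L [mu [P [P_distr P_meas pE]]]]].
have P_ge0 i (s : setting i) l o : 0 <= P i s l o by case: (P_distr i s l).
have P_sum1 i (s : setting i) l : \sum_o P i s l o = 1 by case: (P_distr i s l).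
pose f (g : strategy) l := \prod_u P (tag u) (tagged u) l (g u).
have f_ge0 g l : 0 <= f g l by exact: prodr_ge0.
have f_meas g : measurable_fun setT (fun l => (f g l)%:E).
  by apply/measurable_EFinP; apply: measurable_prod => u _; exact: P_meas.
have sum_f x (a : outcomes x) l :
    \sum_(g | play g x == a) f g l = \prod_i P i (x i) l (a i).
  (* F u vanishes at the answers to u = (i, x i) other than a i, so the product
     of the F u is the indicator of play g x = a times f g. *)
  pose F (u : {i : party S & setting i}) (o : outcome (tagged u)) :=
    if (tagged u == x (tag u)) ==> (Tagged (@outcome S (tag u)) o ==
         Tagged (@outcome S (tag u)) (a (tag u)))
    then P (tag u) (tagged u) l o else 0.
  have FE (g : strategy) :
      \prod_u F u (g u) = if play g x == a then f g l else 0.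
    case: eqP => [ga|nga].
      apply: eq_bigr => -[i s] _; rewrite /F /= -ga ffunE.
      by case: (eqVneq s (x i)) => //= ->; rewrite eqxx.
    have /forallPn[i gi] : ~~ [forall i, play g x i == a i].
      by apply/forallP => H; apply: nga; apply/ffunP => i; apply/eqP.
    rewrite (bigD1 (Tagged _ (x i)))//= {1}/F /= eqxx /= eq_Tagged /=.
    by move: gi; rewrite ffunE => /negbTE ->; rewrite mul0r.
  rewrite big_mkcond; under eq_bigr do rewrite -FE.
  rewrite -(prodr_sum_dffun F).
  rewrite -(sig_big_dep (J := fun i : party S => 'I_(nsetting i) : finType)
    predT (fun _ => predT)
    (fun i s => \sum_o F (Tagged (@setting S) s) o)).
  apply: eq_bigr => i _; rewrite (bigD1 (x i))//= [X in _ * X]big1 ?mulr1.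
    rewrite (bigD1 (a i))//= {1}/F /= eqxx /= eqxx big1 ?addr0// => o oa.
    by rewrite /F /= eqxx /= eq_Tagged /= (negbTE oa).
  by move=> s sx; rewrite /F /= (negbTE sx) /= P_sum1.
have sum_f1 l : \sum_g f g l = 1.
  rewrite -(prodr_sum_dffun (fun u o => P (tag u) (tagged u) l o)).
  by rewrite big1.
have int1 : (\int[mu]_l 1 = 1)%E.
  by rewrite integral_cst// mul1e; exact: probability_setT.
pose w g := fine (\int[mu]_l (f g l)%:E)%E.
(* [f g l] is one term of a nonnegative sum equal to 1, so its integral is finite and [fine] loses
   nothing. *)
have wE g : (w g)%:E = (\int[mu]_l (f g l)%:E)%E.
  apply: fineK; rewrite ge0_fin_numE ?integral_ge0//.
    apply: (@le_lt_trans _ _ (\int[mu]_l 1)%E); last first.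
      by rewrite int1 ltry.
    apply: ge0_le_integral => //; first by move=> l _; rewrite lee_fin.
    move=> l _; rewrite lee_fin -(sum_f1 l) (bigD1 g)//= lerDl.
    exact: sumr_ge0.
  by move=> l _; rewrite lee_fin.
have sum_w (A : pred strategy) :
    (\sum_(g | A g) w g)%:E = (\int[mu]_l (\sum_(g | A g) f g l)%:E)%E.
  under [RHS]eq_integral do rewrite -sumEFin big_mkcond.
  rewrite ge0_integral_sum//; last 2 first.
  - by move=> g; case: (A g) => //.
  - by move=> g l _; case: (A g); rewrite lee_fin.
  rewrite -sumEFin big_mkcond; apply: eq_bigr => g _.
  by case: (A g); rewrite ?wE ?integral0.
exists w.
  split=> [g|].
    by rewrite -lee_fin wE integral_ge0// => l _; rewrite lee_fin.
  apply: EFin_inj; rewrite sum_w; under eq_integral do rewrite sum_f1.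
  exact: int1.
move=> x a; apply: EFin_inj; rewrite pE sum_w.
by apply: eq_integral => l _; rewrite sum_f.
Qed.

(** * From deterministic strategies to Local Friendliness *)

Lemma outcome_inhabited (i : party S) (s : setting i) : outcome s.
Proof. by have /ltnW/card_gt0P/sigW[b] := outcome_ge2 s. Qed.

Definition first_play (g : strategy) : friend_outcomes S :=
  [ffun i => g (Tagged _ (first_setting (val i)))].

(** Provides a strategy to fall back on when [c] has probability zero. *)
Lemma first_play_surj (c : friend_outcomes S) : exists g, first_play g = c.
Proof.
have o0 (u : {i : party S & setting i}) := outcome_inhabited (tagged u).
pose T := {u : {i : party S & setting i} & outcome (tagged u)}.
pose tag_c (i : member (friends S)) : T :=
  existT _ (Tagged (@setting S) (first_setting (val i))) (c i).
exists [ffun u =>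
  odflt (o0 u) [pick o | [exists i, tag_c i == existT _ u o :> T]]].
apply/ffunP => i; rewrite !ffunE.
case: pickP => [b tag_b|/(_ (c i)) /=]; last first.
  by move/negbT/existsPn/(_ i); rewrite eqxx.
move/existsP: tag_b => [j /eqP]; rewrite /tag_c => tag_eq.
have ji : j = i.
  by apply: val_inj; exact: (congr1 (fun t : T => tag (tag t)) tag_eq).
move: tag_eq; rewrite ji => /eqP.
by rewrite eq_Tagged => /eqP.
Qed.

Lemma prod_delta (x : settings S) (a : outcomes x) (c : friend_outcomes S) :
  \prod_(i : member (friends S) | val i \in opened x) delta R a c i =
  [forall i : member (friends S), (val i \in opened x) ==>
     (Tagged (@outcome S (val i)) (a (val i)) ==
      Tagged (@outcome S (val i)) (c i))]%:R.
Proof.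
case: forallP => [ac|/forallP/forallPn[i]].
  by rewrite big1// => i xi; rewrite /delta (implyP (ac i)).
rewrite negb_imply => /andP[xi ac].
by rewrite (bigD1 i)//= /delta (negbTE ac) mul0r.
Qed.

Lemma LF_of_strategies (p : Defs.family R S) (w : strategy -> R) :
  behaviour p -> is_distr w ->
  (forall x (a : outcomes x), p x a = \sum_(g | play g x == a) w g) ->
  LF R S p.
Proof.
move=> bp [w_ge0 w_sum1] pE; split => //.
pose Pc c := \sum_(g | first_play g == c) w g.
have Pc_ge0 c : 0 <= Pc c by exact: sumr_ge0.
pose gc c := projT1 (cid (first_play_surj c)).
have gcE c : first_play (gc c) = c by exact: projT2 (cid (first_play_surj c)).
(* When c has probability zero the conditional distribution is replaced by a
   strategy that still answers c, as required by the third LF condition. *)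
pose q c g : R :=
  if Pc c == 0 then (g == gc c)%:R else (first_play g == c)%:R * w g / Pc c.
have q_supp c g : q c g != 0 -> first_play g = c.
  rewrite /q; case: ifP => _; first by case: (eqVneq g (gc c)) => [->|_ /eqP].
  by case: (eqVneq (first_play g) c) => // _; rewrite !mul0r eqxx.
have q_ge0 c g : 0 <= q c g.
  by rewrite /q; case: ifP => _; rewrite ?divr_ge0 ?mulr_ge0.
have q_sum1 c : \sum_g q c g = 1.
  rewrite /q; case: eqVneq => [_|Pc_neq0].
    by rewrite (bigD1 (gc c))//= eqxx big1 ?addr0// => g /negbTE ->.
  rewrite -mulr_suml -[X in X / _](_ : Pc c = _) ?divff// /Pc big_mkcond.
  by apply: eq_bigr => g _; case: ifP; rewrite ?mul1r ?mul0r.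
have q_Pc g : \sum_c q c g * Pc c = w g.
  have w_le : w g <= Pc (first_play g).
    by rewrite /Pc (bigD1 g)//= lerDl sumr_ge0.
  rewrite (bigD1 (first_play g))//= big1 ?addr0.
    rewrite /q eqxx mul1r; case: eqVneq => [P0|Pc_neq0]; last by rewrite divfK.
    by rewrite P0 mulr0; apply/eqP; rewrite eq_le w_ge0 -P0 w_le.
  move=> c cg; have [->|/q_supp gc'] := eqVneq (q c g) 0.
    by rewrite mul0r.
  by rewrite gc' eqxx in cg.
pose P c : Defs.family R S := fun x a => \sum_(g | play g x == a) q c g.
have marginalP V (c : friend_outcomes S) x
    (aV : suboutcomes (@restr_settings S V x)) :
    marginal (P c x) aV =
    \sum_(g | @restr_outcomes S V x (play g x) == aV) q c g.
  rewrite /marginal /P.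
  by rewrite (sum_fiber (play^~ x) (fun a => @restr_outcomes S V x a == aV)).
exists Pc, P; split.
- split; first split => //.
    by rewrite /Pc (sum_fiber first_play predT).
  move=> c x; split=> [a|]; first exact: sumr_ge0.
  by rewrite /P (sum_fiber (play^~ x) predT).
- move=> x a; rewrite pE /P; under [RHS]eq_bigr do rewrite mulr_suml.
  by rewrite exchange_big; apply: eq_bigr => g _; rewrite q_Pc.
(* Strategies answer party by party, so the marginal on [V] is the weight of those giving [aV] at
   [y], whatever the other settings are. *)
- move=> c V.
  exists (fun y aV => \sum_(g : strategy |
    [forall i : member V, g (Tagged (@setting S) (y i)) == aV i]) q c g).
  move=> x aV; rewrite marginalP; apply: eq_bigl => g.
  apply/eqP/forallP => [<- i|gV]; first by rewrite !ffunE.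
  by apply/ffunP => i; rewrite !ffunE; exact/eqP/(gV i).
- move=> c x a; rewrite marginalP prod_delta.
  have play_opened g i : first_play g = c -> val i \in opened x ->
      Tagged (@outcome S (val i)) (play g x (val i)) =
      Tagged (@outcome S (val i)) (c i).
    by rewrite inE => <- /andP[_ /eqP xi]; rewrite !ffunE xi.
  (* All strategies in the support of [q c] answer [c] on the opened parties: the marginal is the
     total weight 1 if [a] does so too, and 0 otherwise. *)
  case: forallP => [ac|/forallP/forallPn[i]].
    rewrite -(q_sum1 c) big_mkcond; apply: eq_bigr => g _.
    have [->|/q_supp gE] := eqVneq (q c g) 0; first by case: ifP.
    rewrite ifT//; apply/eqP/ffunP => -[i xi]; rewrite !ffunE /=.
    have iF : i \in friends S by move: xi; rewrite inE => /andP[].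
    have /implyP/(_ xi)/eqP := ac (exist _ i iF).
    rewrite -(play_opened g (exist _ i iF))// => /esym/eqP.
    by rewrite eq_Tagged ffunE => /eqP.
  rewrite negb_imply => /andP[xi ac]; rewrite big1// => g /eqP ga.
  apply/eqP; apply: contraNT ac => /q_supp gE.
  rewrite -(play_opened g)//; apply/eqP; congr Tagged.
  by have /ffunP/(_ (exist _ (val i) xi)) := ga; rewrite !ffunE.
Qed.

(** * Local Agency and conditioning on tagged outcomes *)

(* Outcomes paired with their settings, so that events about different strings
   of settings x live in one type. *)
Definition tagged_outcomes := forall i : party S, {s : setting i & outcome s}.

Definition tag_outcomes (x : settings S) (a : outcomes x) : tagged_outcomes :=
  fun i => Tagged (@outcome S i) (a i).

Definition extend (V : {set party S}) (y : subsettings V) (a : suboutcomes y) :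
    tagged_outcomes :=
  fun i => match boolP (i \in V) with
    | AltTrue iV => Tagged (@outcome S i) (a (exist _ i iV))
    | AltFalse _ => Tagged (@outcome S i) (outcome_inhabited (first_setting i))
    end.

Lemma extendE (V : {set party S}) (y : subsettings V) (a : suboutcomes y)
    (i : member V) : extend a (val i) = Tagged (@outcome S (val i)) (a i).
Proof.
case: i => i iV; rewrite /extend /=; case: {-}_ / boolP => [iV'|/negP//].
by rewrite (bool_irrelevance iV' iV).
Qed.

(** Local Agency for expectations: that of a function of the outcomes in [V] is determined by the
    marginal on [V], so settings outside [V] can be changed freely. *)
Lemma local_agency_sum (P : Defs.family R S) (V : {set party S})
    (f : tagged_outcomes -> R) (x x' : settings S) :
  local_agency P -> (forall i, i \in V -> x i = x' i) ->
  (forall t t', (forall i, i \in V -> t i = t' i) -> f t = f t') ->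
  \sum_(a : outcomes x) P x a * f (tag_outcomes a) =
  \sum_(a : outcomes x') P x' a * f (tag_outcomes a).
Proof.
move=> /(_ V)[Q QE] xx' fV.
pose G (y : subsettings V) := \sum_(aV : suboutcomes y) Q y aV * f (extend aV).
suff GE z : \sum_(a : outcomes z) P z a * f (tag_outcomes a) =
    G (@restr_settings S V z).
  rewrite !GE; congr G; apply: functional_extensionality_dep => i.
  exact: xx' (valP i).
rewrite /G; under [RHS]eq_bigr do rewrite -QE mulr_suml.
rewrite -(sum_fiber (@restr_outcomes S V z) predT).
apply: eq_bigr => aV _; apply: eq_bigr => a /eqP <-; congr (_ * _).
apply: fV => i iV; rewrite (extendE _ (exist _ i iV)).
by rewrite /tag_outcomes ffunE.
Qed.

Lemma sum_tagged (i : party S) (s : setting i)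
    (u : {s : setting i & outcome s}) :
  tag u = s -> \sum_(b : outcome s) (u == Tagged (@outcome S i) b)%:R = 1 :> R.
Proof.
case: u => s' b' /= E; case: s / E.
rewrite (bigD1 b')//= eqxx big1 ?addr0// => b bb'.
by rewrite eq_Tagged /= eq_sym (negbTE bb').
Qed.

(** Masks coordinate [k], so that agreement outside [k] becomes a Boolean equality. *)
Definition off (k : party S) (t : tagged_outcomes) :
    {dffun forall i : party S, option {s : setting i & outcome s}} :=
  [ffun i => if i == k then None else Some (t i)].

Lemma offP (k : party S) (t t' : tagged_outcomes) :
  off k t = off k t' <-> (forall i, i != k -> t i = t' i).
Proof.
split=> [/ffunP tt' i ik|tt'].
  by have := tt' i; rewrite !ffunE (negbTE ik) => -[].
by apply/ffunP => i; rewrite !ffunE; case: eqVneq => // /tt' ->.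
Qed.

(* 0-based value 1, the paper's setting 2. *)
Definition base_setting (i : party S) : setting i := Ordinal (nsetting_ge2 i).

Definition base_with (i : party S) (s : setting i) : settings S :=
  eqtype.dfwith base_setting s.

(* The distribution of the outcome of party i at setting s, the other parties
   being at [base_setting] and conditioned on their outcomes in t. *)
Definition response (q : Defs.family R S) (i : party S) (s : setting i)
    (t : tagged_outcomes) (b : outcome s) : R :=
  let same (a : outcomes (base_with s)) := off i (tag_outcomes a) == off i t in
  if \sum_(a | same a) q (base_with s) a == 0
  then (b == outcome_inhabited s)%:R
  else (\sum_(a | same a && (tag_outcomes a i == Tagged (@outcome S i) b))
          q (base_with s) a) / \sum_(a | same a) q (base_with s) a.

Lemma response_distr (q : Defs.family R S) (i : party S) (s : setting i) t :
  behaviour q -> is_distr (response q t (s := s)).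
Proof.
move=> bq; have q_ge0 a : 0 <= q (base_with s) a by case: (bq (base_with s)).
split=> [b|]; rewrite /response; case: eqVneq => [_|D_neq0] //.
- by rewrite divr_ge0// sumr_ge0.
- rewrite (bigD1 (outcome_inhabited s))//= eqxx big1 ?addr0//.
  by move=> b /negbTE ->.
rewrite -mulr_suml; under eq_bigr do rewrite big_mkcondr.
rewrite exchange_big.
rewrite -[X in X / _](_ : \sum_(a | off i (tag_outcomes a) == off i t)
  q (base_with s) a = _) ?divff//.
apply: eq_bigr => a _; rewrite -[LHS]mulr1.
rewrite -(@sum_tagged i s (tag_outcomes a i)); last exact: eqtype.dfwith_in.
by rewrite mulr_sumr; apply: eq_bigr => b _; case: ifP; rewrite ?mulr1 ?mulr0.
Qed.

(** * The local model for a fixed [c] *)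

Definition friendly_response (q : Defs.family R S) (c : friend_outcomes S)
    (t : tagged_outcomes) (i : party S) (s : setting i) (o : outcome s) : R :=
  if i \in friends S then
    (Tagged (@outcome S i) o ==
     if s == first_setting i then extend c i else t i)%:R
  else response q t o.

(** [q x a] is at most its marginal on the opened parties, which the product of deltas makes 0
    unless the outcomes agree with [c]. *)
Lemma opened_support (q : Defs.family R S) (c : friend_outcomes S) x
    (a : outcomes x) :
  behaviour q ->
  marginal (q x) (@restr_outcomes S (opened x) x a) =
    \prod_(i : member (friends S) | val i \in opened x) delta R a c i ->
  q x a != 0 -> forall i, i \in opened x -> tag_outcomes a i = extend c i.
Proof.
move=> bq margE qa_neq0 i xi.
have iF : i \in friends S by move: xi; rewrite inE => /andP[].
have q_ge0 b : 0 <= q x b by case: (bq x).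
have : q x a <= marginal (q x) (@restr_outcomes S (opened x) x a).
  by rewrite /marginal (bigD1 a)//= lerDl sumr_ge0.
rewrite margE prod_delta; case: forallP => [ac _|_ qa_le0]; last first.
  by move: qa_neq0; rewrite eq_le q_ge0 qa_le0.
rewrite (extendE c (exist _ i iF)).
by have /implyP/(_ xi)/eqP := ac (exist _ i iF).
Qed.

Lemma friendly_response_sum (q : Defs.family R S) (c : friend_outcomes S)
    (k : party S) x (a : outcomes x) :
  behaviour q -> local_agency q ->
  (forall i, (i \in friends S) = (i != k)) ->
  (forall i (s : setting i), i != k -> s != first_setting i ->
    s = base_setting i) ->
  (forall x (a : outcomes x),
    marginal (q x) (@restr_outcomes S (opened x) x a) =
    \prod_(i : member (friends S) | val i \in opened x) delta R a c i) ->
  q x a = \sum_(b : outcomes base_setting)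
    q base_setting b * \prod_i friendly_response q c (tag_outcomes b) (a i).
Proof.
move=> bq LA friendE secondE margE.
have q_ge0 z b : 0 <= q z b by case: (bq z).
have support z b := @opened_support q c z b bq (margE z b).
have openedE z i : (i \in opened z) = (i != k) && (z i == first_setting i).
  by rewrite inE friendE.
(* If [a] contradicts [c] at an opened party, both sides vanish. *)
have [ac|] := boolP [forall i,
    (i \in opened x) ==> (tag_outcomes a i == extend c i)]; last first.
  case/forallPn => i; rewrite negb_imply => /andP[xi ac].
  have -> : q x a = 0.
    by apply/eqP; apply: contraNT ac => /support/(_ i xi) ->.
  rewrite big1// => b _; rewrite (bigD1 i)//=.
  move: xi; rewrite openedE => /andP[ik xi].
  by rewrite /friendly_response friendE ik xi (negbTE ac) mul0r mulr0.
have {}ac i : i \in opened x -> tag_outcomes a i = extend c i.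
  by move=> xi; apply/eqP; exact: implyP (forallP ac i) xi.
(* The joint response of the friends not at their first setting. *)
pose g (t : tagged_outcomes) : R :=
  [forall i,
    (i != k) && (x i != first_setting i) ==> (tag_outcomes a i == t i)]%:R.
pose xk := base_with (x k).
have xkk : xk k = x k by exact: eqtype.dfwith_in.
have xk_off i : i != k -> xk i = base_setting i.
  by move=> ik; rewrite /xk /base_with eqtype.dfwith_out// eq_sym.
have gE t t' : (forall i, i != k -> t i = t' i) -> g t = g t'.
  move=> tt'; rewrite /g; congr (nat_of_bool _)%:R; apply: eq_forallb => i.
  by case: (eqVneq i k) => //= /tt' ->.
have prodE b : \prod_i friendly_response q c (tag_outcomes b) (a i) =
    g (tag_outcomes b) * response q (tag_outcomes b) (a k).
  rewrite (bigD1 k)//= {1}/friendly_response friendE eqxx /= mulrC.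
  congr (_ * _).
  rewrite /g; case: forallP => [ab|/forallP/forallPn[i]].
    rewrite big1// => i ik; rewrite /friendly_response friendE ik.
    case: (eqVneq (x i) (first_setting i)) => [xi|xi].
      have xi' : i \in opened x by rewrite openedE ik xi eqxx.
      by rewrite -(ac i xi') eqxx.
    by have /implyP/(_ _)/eqP <- := ab i; rewrite ?ik ?xi// eqxx.
  rewrite negb_imply => /andP[/andP[ik xi] ab].
  rewrite (bigD1 i)//= /friendly_response friendE ik (negbTE xi).
  by rewrite (negbTE ab) mul0r.
under eq_bigr do rewrite prodE.
(* The summand depends on the friends' outcomes only, so party [k] may move from [base_setting] to
   [x k]. *)
rewrite (@local_agency_sum q (friends S)
    (fun t => g t * response q t (a k)) _ xk)//; first last.
- move=> t t' tt'; have {}tt' i : i != k -> t i = t' i.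
    by rewrite -friendE; exact: tt'.
  rewrite (gE _ _ tt') /response.
  by have /offP -> := tt'.
- by move=> i; rewrite friendE => /xk_off.
rewrite /response.
(* Averaging the conditional probability of [a k] over the friends' outcomes turns it into the event
   that [k] answers [a k]. *)
rewrite (@sum_cond_expectation _ _ _
  (fun b : outcomes xk => off k (tag_outcomes b)) (q xk)
  (fun b => g (tag_outcomes b))
  (fun _ => (a k == outcome_inhabited (x k))%:R)
  (fun b => tag_outcomes b k == tag_outcomes a k) (q_ge0 xk)); last first.
  by move=> b b' /offP; exact: gE.
pose f (t : tagged_outcomes) : R := (t k == tag_outcomes a k)%:R * g t.
transitivity (\sum_(b : outcomes x) q x b * f (tag_outcomes b)); last first.
  (* The event concerns only [k] and the unopened friends, where [x] and [xk] agree by [secondE];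
     the opened friends may thus change settings. *)
  rewrite (@local_agency_sum q
    [set i | (i == k) || (x i != first_setting i)] f x xk)//.
  - rewrite [RHS]big_mkcond; apply: eq_bigr => b _; rewrite /f.
    by case: eqP; rewrite ?mul1r// mul0r mulr0.
  - move=> i; rewrite inE.
    have [->|ik /= xi] := eqVneq i k; first by rewrite xkk.
    by rewrite xk_off//; exact: secondE.
  - move=> t t' tt'; rewrite /f (tt' k) ?inE ?eqxx//; congr (_ * _).
    rewrite /g; congr (nat_of_bool _)%:R; apply: eq_forallb => i.
    by case: (boolP (_ && _)) => //= /andP[_ xi]; rewrite tt'// inE xi orbT.
rewrite (bigD1 a)//= {1}/f eqxx mul1r /g.
rewrite (_ : [forall i, _] = true) ?mulr1; last first.
  by apply/forallP => i; rewrite eqxx implybT.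
(* No other [b] contributes: it would agree with [a] at [k] and the unopened friends by the event,
   and at the opened friends because both follow [c]. *)
rewrite big1 ?addr0// => b ba; apply/eqP; apply: contraNT ba.
rewrite !mulf_eq0 !negb_or => /and3P[/support bc].
rewrite !pnatr_eq0 !eqb0 !negbK => /eqP bk /forallP ab.
apply/eqP/ffunP => i.
suff /eqP : tag_outcomes b i = tag_outcomes a i by rewrite eq_Tagged => /eqP.
have [->//|ik] := eqVneq i k.
have [xi|xi] := eqVneq (x i) (first_setting i).
  have xi' : i \in opened x by rewrite openedE ik xi eqxx.
  by rewrite bc// ac.
by apply/esym/eqP; have /implyP := ab i; apply; rewrite ik.
Qed.

End FiniteModels.

(** * The two inclusions *)

Theorem theorem14 (R : realType) (S : scenario)
    (hF : #|friends S| = (#|{: party S}| - 1)%N)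
    (hM : forall j : party S, j \in friends S -> #|{: setting j}| = 2%N) :
  LF R S = LHV R S.
Proof.
have [k friendE] : exists k, forall i, (i \in friends S) = (i != k).
  have : #|~: friends S| == 1%N.
    rewrite cardsCs finset.setCK hF subKn// card_ord.
    exact: leq_trans (nparty_ge2 S).
  case/cards1P => k kE; exists k => i.
  have := congr1 (fun A : {set party S} => i \in A) kE.
  by rewrite !inE => <-; rewrite negbK.
have secondE i (s : setting i) :
    i != k -> s != first_setting i -> s = base_setting i.
  rewrite -friendE => /hM; rewrite card_ord => m2 s1; apply: val_inj.
  have := ltn_ord s; rewrite {2}m2.
  by move: s1; rewrite -val_eqE /=; case: (nat_of_ord s) => [|[|]].
rewrite eqEsubset; split=> p; last first.
  move=> LHVp; have [w w_distr wE] := LHV_strategies LHVp.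
  by apply: LF_of_strategies w_distr wE; case: LHVp.
move=> [bp [Pc [P [[[Pc_ge0 Pc_sum1] bP] pE LA margE]]]].
pose w (cb : friend_outcomes S * outcomes (@base_setting S)) : R :=
  Pc cb.1 * P cb.1 _ cb.2.
pose resp i (s : setting i)
    (cb : friend_outcomes S * outcomes (@base_setting S)) (o : outcome s) : R :=
  friendly_response (P cb.1) cb.1 (tag_outcomes cb.2) o.
apply: (@LHV_of_finite R S p _ w resp) => //.
- split=> [cb|]; first by rewrite mulr_ge0//; case: (bP cb.1 (@base_setting S)).
  rewrite -(pair_bigA _ (fun c b => Pc c * P c (@base_setting S) b)) /=.
  rewrite -[RHS]Pc_sum1; apply: eq_bigr => c _.
  by rewrite -mulr_sumr; case: (bP c (@base_setting S)) => _ ->; rewrite mulr1.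
- move=> i s [c b]; rewrite /resp /friendly_response /=.
  have [iF|iF] := boolP (i \in friends S); last exact: response_distr.
  split=> [b0|] //.
  under eq_bigr do rewrite eq_sym.
  (* The prescribed answer must carry the setting [s]. Away from the first setting it carries
     [base_setting i], which equals [s] because a friend has two settings. *)
  apply: sum_tagged; case: eqVneq => [->|s1].
    by rewrite (extendE c (exist _ i iF)).
  by rewrite /=; apply/esym/secondE; rewrite -?friendE.
- move=> x a; rewrite pE.
  rewrite -(pair_bigA _ (fun c b => Pc c * P c (@base_setting S) b *
    \prod_i friendly_response (P c) c (tag_outcomes b) (a i))) /=.
  apply: eq_bigr => c _.
  rewrite (friendly_response_sum a (bP c) (LA c) friendE secondE (margE c)).
  by rewrite mulrC mulr_sumr; apply: eq_bigr => b _; rewrite mulrA.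
Qed.
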